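(* Let $\pi$ be a group, $w:\pi\to\mathbb{Z}^\times=\{\pm1\}$ a homomorphism and $M$ a finitely generated projective left $\mathbb{Z}[\pi]$-module. Let $B_M:\mathbb{Z}^w\otimes_{\mathbb{Z}[\pi]}\Gamma_W(M)\to Her_w(M^\dagger)$ be the homomorphism induced by evaluation (defined in the context). If $\mathrm{Ker}(w)$ has no element of order $2$ then $B_M$ is surjective, while if there is no element $g\in\pi$ of order $2$ such that $w(g)=-1$ then $B_M$ is injective.
   Context: $\mathbb{Z}[\pi]$ has the involution determined by $\bar g=w(g)g^{-1}$ for $g\in\pi$. For a right $\mathbb{Z}[\pi]$-module $R$, $\overline{R}$ is the left module with the same underlying group and $g\cdot r=r\cdot\bar g$. For a left module $M$, $M^\dagger=\overline{Hom_{\mathbb{Z}[\pi]}(M,\mathbb{Z}[\pi])}$. $\mathbb{Z}^w$ is $\mathbb{Z}$ with $g\in\pi$ acting (on either side) by multiplication by $w(g)$. A function $f:A\to B$ between abelian groups is quadratic if $f(-a)=f(a)$ for all $a$ and $f(a+b)-f(a)-f(b)$ is bilinear in $(a,b)$. The Whitehead quadratic functor $\Gamma_W$ assigns to each abelian group $A$ an abelian group $\Gamma_W(A)$ and a quadratic function $\gamma_A:A\to\Gamma_W(A)$ which is universal for quadratic functions with domain $A$. If $M$ is a $\mathbb{Z}[\pi]$-module then $\Gamma_W(M)$ is a $\mathbb{Z}[\pi]$-module by functoriality. A $w$-hermitean pairing on a $\mathbb{Z}[\pi]$-module $N$ is a function $b:N\times N\to\mathbb{Z}[\pi]$ which is $\mathbb{Z}[\pi]$-linear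 in the first variable and satisfies $b(n,m)=\overline{b(m,n)}$ for all $m,n\in N$. $Her_w(N)$ is the abelian group of $w$-hermitean pairings on $N$. For $m\in M$ and $n,n'\in M^\dagger$ let $ev_M(m)(n,n')=\overline{n(m)}\,n'(m)$. This is quadratic in $m$, $w$-hermitean in $(n,n')$, and $ev_M(gm)=w(g)ev_M(m)$ for $g\in\pi$; hence $ev_M$ determines a homomorphism $B_M:\mathbb{Z}^w\otimes_{\mathbb{Z}[\pi]}\Gamma_W(M)\to Her_w(M^\dagger)$ with $B_M(1\otimes\gamma_M(m))=ev_M(m)$. *)

(* Defs.v *)
From HB Require Import structures.
From mathcomp Require Import all_boot all_order all_algebra.
From mathcomp Require Import finmap.
From mathcomp.classical Require Import boolp functions.
From mathcomp.multinomials Require Import monalg.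

Set Implicit Arguments.
Unset Strict Implicit.
Unset Printing Implicit Defensive.

Import GRing.Theory.
Local Open Scope ring_scope.

(** [{malg int[K]}] is the free abelian group on [K], with basis the [<< k >>];
    [malg_lift f] is the additive extension of [f]. *)
HB.lock Definition malg_lift (K : choiceType) (V : zmodType) (f : K -> V)
    (a : {malg int[K]}) : V :=
  \sum_(k <- msupp a) f k *~ a@_k.

Section FreeAbelian.
Variables (K : choiceType) (V : zmodType) (f : K -> V).

Lemma malg_liftEw (d : {fset K}) a : (msupp a `<=` d)%fset ->
  malg_lift f a = \sum_(k <- d) f k *~ a@_k.
Proof.
move=> le; rewrite malg_lift.unlock (big_fset_incl _ le) //=.
by move=> k _ /mcoeff_outdom ->; rewrite mulr0z.
Qed.

Lemma malg_lift_is_zmod_morphism : zmod_morphism (malg_lift f).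
Proof.
move=> a b; set d := (msupp a `|` msupp b)%fset.
rewrite (@malg_liftEw d) ?msuppB_le // (@malg_liftEw d a) ?fsubsetUl //.
rewrite (@malg_liftEw d b) ?fsubsetUr // -sumrB; apply: eq_bigr => k _.
by rewrite mcoeffB mulrzBr.
Qed.

HB.instance Definition _ :=
  GRing.isZmodMorphism.Build {malg int[K]} V (malg_lift f)
    malg_lift_is_zmod_morphism.

Lemma malg_liftU k : malg_lift f << k >> = f k.
Proof. by rewrite (malg_liftEw msuppU_le) big_seq_fset1 mcoeffUU. Qed.

End FreeAbelian.

Lemma malg_ind (K : choiceType) (P : {malg int[K]} -> Prop) :
    P 0 -> (forall a b, P a -> P b -> P (a - b)) -> (forall k, P << k >>) ->
  forall a, P a.
Proof.
move=> P0 PB P1 a.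
have PN b : P b -> P (- b) by move=> Pb; rewrite -[- b]add0r; apply: PB.
have PD b c : P b -> P c -> P (b + c).
  by move=> Pb /PN Pc; rewrite -[c]opprK; apply: PB.
rewrite [a]monalgE; elim/big_ind: _ => // k _.
have PMn n : P << n%:Z *g k >>.
  elim: n => [|n IHn]; first by rewrite monalgU0.
  by rewrite -addn1 PoszD monalgUD; apply: PD.
by case: (a@_k) => n //; rewrite NegzE monalgUN; apply/PN/PMn.
Qed.

Lemma malg_additive_eq (K : choiceType) (V : zmodType)
    (f g : {additive {malg int[K]} -> V}) :
  (forall k, f << k >> = g << k >>) -> f =1 g.
Proof.
move=> fg; elim/malg_ind => [|a b fga fgb|//]; first by rewrite !raddf0.
by rewrite !raddfB fga fgb.
Qed.

Section AbelianQuotient.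
Variables (V : zmodType) (S : V -> Prop).

(** The smallest subgroup of [V] containing [S]. *)
Definition subgroup_gen : {pred V} := fun x =>
  `[< forall P : V -> Prop, P 0 -> (forall a b, P a -> P b -> P (a - b)) ->
      (forall s, S s -> P s) -> P x >].

Lemma subgroup_genP x : reflect
  (forall P : V -> Prop, P 0 -> (forall a b, P a -> P b -> P (a - b)) ->
     (forall s, S s -> P s) -> P x) (x \in subgroup_gen).
Proof. by rewrite unfold_in; apply: asboolP. Qed.

Lemma subgroup_gen_zmod_closed : zmod_closed subgroup_gen.
Proof.
split=> [|x y /subgroup_genP Sx /subgroup_genP Sy].
  by apply/subgroup_genP.
by apply/subgroup_genP => P P0 PB PS; apply: (PB _ _ (Sx P _ _ _) (Sy P _ _ _)).
Qed.

HB.instance Definition _ :=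
  GRing.isZmodClosed.Build V subgroup_gen subgroup_gen_zmod_closed.

Definition zquot : Type := Quotient.quot subgroup_gen.
HB.instance Definition _ := GRing.Zmodule.on zquot.

Definition zquot_pi (x : V) : zquot := (\pi_(Quotient.quot subgroup_gen) x)%qT.

Lemma zquot_pi_is_zmod_morphism : zmod_morphism zquot_pi.
Proof. by move=> x y; rewrite /zquot_pi raddfB. Qed.

HB.instance Definition _ :=
  GRing.isZmodMorphism.Build V zquot zquot_pi zquot_pi_is_zmod_morphism.

Lemma zquot_pi_eq0 x : zquot_pi x = 0 <-> x \in subgroup_gen.
Proof.
have -> : (x \in subgroup_gen) = (zquot_pi x == zquot_pi 0).
  by rewrite /zquot_pi -Quotient.idealrBE subr0.
by rewrite raddf0; split=> [->|/eqP].
Qed.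

Lemma zquot_rel s : S s -> zquot_pi s = 0.
Proof. by move=> Ss; apply/zquot_pi_eq0/subgroup_genP => P _ _; apply. Qed.

Lemma zquot_eq x y : S (x - y) -> zquot_pi x = zquot_pi y.
Proof. by move=> /zquot_rel; rewrite raddfB => /subr0_eq. Qed.

Lemma zquot_reprK (y : Quotient.quot subgroup_gen) : zquot_pi (repr y) = y.
Proof. exact: reprK. Qed.

Lemma zquot_ind (P : zquot -> Prop) :
  (forall x, P (zquot_pi x)) -> forall y, P y.
Proof. by move=> Ppi y; rewrite -[y]zquot_reprK; apply: Ppi. Qed.

End AbelianQuotient.

HB.lock Definition zquot_lift (V : zmodType) (S : V -> Prop) (B : zmodType)
    (f : {additive V -> B}) of (forall s, S s -> f s = 0) : zquot S -> B :=
  fun y => f (repr (y : Quotient.quot (subgroup_gen S))).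

Section QuotientLift.
Variables (V : zmodType) (S : V -> Prop) (B : zmodType) (f : {additive V -> B}).
Hypothesis fS : forall s, S s -> f s = 0.

Lemma zquot_liftE x : zquot_lift fS (zquot_pi S x) = f x.
Proof.
rewrite zquot_lift.unlock.
apply/eqP; rewrite -subr_eq0 -raddfB; apply/eqP.
have /zquot_pi_eq0/subgroup_genP :
    zquot_pi S (repr (zquot_pi S x : Quotient.quot (subgroup_gen S)) - x) = 0.
  by rewrite raddfB /= zquot_reprK subrr.
move=> /(_ (fun v => f v = 0)); apply=> //; first exact: raddf0.
by move=> a b fa fb; rewrite raddfB fa fb subrr.
Qed.

Lemma zquot_lift_is_zmod_morphism : zmod_morphism (zquot_lift fS).
Proof.
elim/zquot_ind => x; elim/zquot_ind => y.
by rewrite -raddfB !zquot_liftE raddfB.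
Qed.

HB.instance Definition _ :=
  GRing.isZmodMorphism.Build (zquot S) B (zquot_lift fS)
    zquot_lift_is_zmod_morphism.
End QuotientLift.

Definition polar (A B : zmodType) (f : A -> B) (a b : A) : B :=
  f (a + b) - f a - f b.

Definition biadditive (A B C : zmodType) (f : A -> B -> C) : Prop :=
  (forall a a' b, f (a + a') b = f a b + f a' b) /\
  (forall a b b', f a (b + b') = f a b + f a b').

Definition quadratic (A B : zmodType) (f : A -> B) : Prop :=
  (forall a, f (- a) = f a) /\ biadditive (polar f).

Section GammaW.
Variable A : zmodType.

Let delta (a : A) : {malg int[A]} := << a >>.

Inductive gammaW_rel : {malg int[A]} -> Prop :=
| gammaW_relN a : gammaW_rel (delta (- a) - delta a)
| gammaW_relDl a a' b :
    gammaW_rel (polar delta (a + a') b - (polar delta a b + polar delta a' b))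
| gammaW_relDr a b b' :
    gammaW_rel (polar delta a (b + b') - (polar delta a b + polar delta a b')).

Definition gammaW : Type := zquot gammaW_rel.
HB.instance Definition _ := GRing.Zmodule.on gammaW.

Definition gammaW_pi : {malg int[A]} -> gammaW := zquot_pi gammaW_rel.
HB.instance Definition _ :=
  GRing.isZmodMorphism.Build {malg int[A]} gammaW gammaW_pi
    (@zquot_pi_is_zmod_morphism _ gammaW_rel).

Definition gamma (a : A) : gammaW := gammaW_pi (delta a).

Lemma polar_gamma a b : polar gamma a b = gammaW_pi (polar delta a b).
Proof. by rewrite /polar !raddfB. Qed.

Lemma gamma_quadratic : quadratic gamma.
Proof.
split=> [a|]; first by apply: zquot_eq; constructor.
split=> [a a' b|a b b'].
- apply: etrans (polar_gamma _ _) _.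
  apply: etrans (zquot_eq (gammaW_relDl a a' b)) _.
  by apply: etrans (raddfD gammaW_pi _ _) _; congr (_ + _);
    apply/esym/polar_gamma.
- apply: etrans (polar_gamma _ _) _.
  apply: etrans (zquot_eq (gammaW_relDr a b b')) _.
  by apply: etrans (raddfD gammaW_pi _ _) _; congr (_ + _);
    apply/esym/polar_gamma.
Qed.

Section Lift.
Variables (B : zmodType) (f : A -> B).

Lemma gammaW_lift_subproof : quadratic f ->
  forall s, gammaW_rel s -> malg_lift f s = 0.
Proof.
move=> [fN [fDl fDr]]; have pE a b : malg_lift f (polar delta a b) = polar f a b.
  by rewrite /polar !raddfB /= !malg_liftU.
move=> _ [a|a a' b|a b b']; apply/eqP.
- by rewrite raddfB /= !malg_liftU fN subrr.
- by rewrite raddfB [X in _ - X]raddfD /= !pE fDl subrr.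
- by rewrite raddfB [X in _ - X]raddfD /= !pE fDr subrr.
Qed.

Definition gammaW_lift (fq : quadratic f) : gammaW -> B :=
  zquot_lift (gammaW_lift_subproof fq).
HB.instance Definition _ fq :=
  GRing.isZmodMorphism.Build gammaW B (gammaW_lift fq)
    (zquot_lift_is_zmod_morphism (gammaW_lift_subproof fq)).

Lemma gammaW_liftE (fq : quadratic f) a : gammaW_lift fq (gamma a) = f a.
Proof. exact: etrans (zquot_liftE _ _) (malg_liftU _ _). Qed.
End Lift.

Lemma gammaW_additive_eq (B : zmodType) (f g : {additive gammaW -> B}) :
  (forall a, f (gamma a) = g (gamma a)) -> f =1 g.
Proof.
move=> fg; elim/zquot_ind => x.
exact: (@malg_additive_eq _ _ (f \o gammaW_pi) (g \o gammaW_pi) fg x).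
Qed.

End GammaW.

Section GammaWMap.
Variables (A B : zmodType) (f : {additive A -> B}).

Lemma gamma_comp_quadratic : quadratic (fun a => gamma (f a)).
Proof.
have [gN [gDl gDr]] := gamma_quadratic B.
have pE a b : polar (fun a => gamma (f a)) a b = polar (@gamma B) (f a) (f b).
  by rewrite /polar raddfD.
split=> [a|]; first by rewrite raddfN gN.
by split=> *; rewrite !pE raddfD ?gDl ?gDr.
Qed.

Definition gammaW_map : gammaW A -> gammaW B := gammaW_lift gamma_comp_quadratic.
HB.instance Definition _ := GRing.Additive.on gammaW_map.

Lemma gammaW_mapE a : gammaW_map (gamma a) = gamma (f a).
Proof. exact: gammaW_liftE. Qed.
End GammaWMap.

(** Right [R]-modules are left modules over the converse ring [R^c]: for
    [r : R] and [n : N], the term [(r : R^c) *: n] stands for [n r]. *)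
Section Tensor.
Variables (R : pzRingType) (N : lmodType R^c) (P : lmodType R).

Let delta (n : N) (p : P) : {malg int[(N * P)%type]} := << (n, p) >>.

Inductive tensor_rel : {malg int[(N * P)%type]} -> Prop :=
| tensor_relDl n n' p :
    tensor_rel (delta (n + n') p - (delta n p + delta n' p))
| tensor_relDr n p p' :
    tensor_rel (delta n (p + p') - (delta n p + delta n p'))
| tensor_relZ n (r : R) p :
    tensor_rel (delta ((r : R^c) *: n) p - delta n (r *: p)).

Definition tensor : Type := zquot tensor_rel.
HB.instance Definition _ := GRing.Zmodule.on tensor.

Definition tensor_pi : {malg int[(N * P)%type]} -> tensor := zquot_pi tensor_rel.
HB.instance Definition _ :=
  GRing.isZmodMorphism.Build {malg int[(N * P)%type]} tensor tensor_pi
    (@zquot_pi_is_zmod_morphism _ tensor_rel).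

Definition tens (n : N) (p : P) : tensor := tensor_pi (delta n p).

Definition balanced (B : zmodType) (f : N -> P -> B) : Prop :=
  biadditive f /\ forall n (r : R) p, f ((r : R^c) *: n) p = f n (r *: p).

Lemma tens_balanced : balanced tens.
Proof.
split=> [|n r p]; last exact: zquot_eq (tensor_relZ n r p).
split=> [n n' p|n p p'].
- exact: etrans (zquot_eq (tensor_relDl n n' p)) (raddfD tensor_pi _ _).
- exact: etrans (zquot_eq (tensor_relDr n p p')) (raddfD tensor_pi _ _).
Qed.

Section Lift.
Variables (B : zmodType) (f : N -> P -> B).
Let f2 (np : N * P) := f np.1 np.2.

Lemma tensor_lift_subproof : balanced f ->
  forall s, tensor_rel s -> malg_lift f2 s = 0.
Proof.
move=> [[fDl fDr] fZ] _ [n n' p|n p p'|n r p]; apply/eqP.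
- by rewrite raddfB [X in _ - X]raddfD /= !malg_liftU /f2 /= fDl subrr.
- by rewrite raddfB [X in _ - X]raddfD /= !malg_liftU /f2 /= fDr subrr.
- by rewrite raddfB /= !malg_liftU /f2 /= fZ subrr.
Qed.

Definition tensor_lift (fb : balanced f) : tensor -> B :=
  zquot_lift (tensor_lift_subproof fb).
HB.instance Definition _ fb :=
  GRing.isZmodMorphism.Build tensor B (tensor_lift fb)
    (zquot_lift_is_zmod_morphism (tensor_lift_subproof fb)).

Lemma tensor_liftE (fb : balanced f) n p : tensor_lift fb (tens n p) = f n p.
Proof. exact: etrans (zquot_liftE _ _) (malg_liftU _ _). Qed.
End Lift.

Lemma tensor_additive_eq (B : zmodType) (f g : {additive tensor -> B}) :
  (forall n p, f (tens n p) = g (tens n p)) -> f =1 g.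
Proof.
move=> fg; elim/zquot_ind => x.
by apply: (@malg_additive_eq _ _ (f \o tensor_pi) (g \o tensor_pi))
  => -[n p] /=; apply: fg.
Qed.
End Tensor.

Section GroupRing.
Variable pi : groupType.

Definition groupring : Type := {malg int[pi]}.
HB.instance Definition _ := GRing.Zmodule.on groupring.

Definition gr (g : pi) : groupring := << g >>.

Definition gr_mul (a b : groupring) : groupring :=
  malg_lift (fun g => malg_lift (fun h => gr (g * h)%g) b) a.

Lemma gr_mulDl : left_distributive gr_mul +%R.
Proof. by move=> a b c; rewrite /gr_mul raddfD. Qed.

Lemma gr_mulDr : right_distributive gr_mul +%R.
Proof.
move=> a b c; rewrite /gr_mul !(malg_liftEw _ (fsubset_refl _)).
by rewrite -big_split; apply: eq_bigr => g _; rewrite raddfD mulrzDl.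
Qed.

Lemma gr_mulBl a b c : gr_mul (a - b) c = gr_mul a c - gr_mul b c.
Proof. by rewrite /gr_mul raddfB. Qed.

Lemma gr_mulBr a b c : gr_mul a (b - c) = gr_mul a b - gr_mul a c.
Proof. by apply/eqP; rewrite eq_sym subr_eq -gr_mulDr subrK. Qed.

Lemma gr_mul0l a : gr_mul 0 a = 0.
Proof. by rewrite /gr_mul raddf0. Qed.

Lemma gr_mul0r a : gr_mul a 0 = 0.
Proof. by rewrite -[X in gr_mul a X](subrr a) gr_mulBr subrr. Qed.

Lemma gr_mulgg g h : gr_mul (gr g) (gr h) = gr (g * h)%g.
Proof. by rewrite /gr_mul !malg_liftU. Qed.

Lemma gr_ind (P : groupring -> Prop) :
    P 0 -> (forall a b, P a -> P b -> P (a - b)) -> (forall g, P (gr g)) ->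
  forall a, P a.
Proof. exact: malg_ind. Qed.

Lemma gr_mulA : associative gr_mul.
Proof.
move=> a b c; elim/gr_ind: a => [|a a' IH IH'|g].
- by rewrite !gr_mul0l.
- by rewrite !gr_mulBl IH IH'.
elim/gr_ind: b => [|b b' IH IH'|h].
- by rewrite gr_mul0r !gr_mul0l gr_mul0r.
- by rewrite gr_mulBr !gr_mulBl gr_mulBr IH IH'.
elim/gr_ind: c => [|c c' IH IH'|k].
- by rewrite !gr_mul0r.
- by rewrite !gr_mulBr IH IH'.
by rewrite !gr_mulgg mulgA.
Qed.

Lemma gr_mul1l : left_id (gr 1%g) gr_mul.
Proof.
elim/gr_ind => [|a b IH IH'|g]; first exact: gr_mul0r.
  by rewrite gr_mulBr IH IH'.
by rewrite gr_mulgg mul1g.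
Qed.

Lemma gr_mul1r : right_id (gr 1%g) gr_mul.
Proof.
elim/gr_ind => [|a b IH IH'|g]; first exact: gr_mul0l.
  by rewrite gr_mulBl IH IH'.
by rewrite gr_mulgg mulg1.
Qed.

Lemma gr1_neq0 : gr 1%g != 0.
Proof. by rewrite monalgU_eq0. Qed.

HB.instance Definition _ := GRing.Zmodule_isNzRing.Build groupring
  gr_mulA gr_mul1l gr_mul1r gr_mulDl gr_mulDr gr1_neq0.

Lemma grM g h : gr (g * h)%g = gr g * gr h.
Proof. by rewrite -gr_mulgg. Qed.

Lemma gr1 : gr 1%g = 1.
Proof. by []. Qed.

End GroupRing.

(** The condition [w 1 = 1] follows, see [orient1]. *)
Record orientation (pi : groupType) := Orientation {
  orient :> pi -> int;
  orient_pm1 : forall g, orient g = 1 \/ orient g = -1;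
  orientM : forall g h, orient (g * h)%g = orient g * orient h
}.

Section Involution.
Variables (pi : groupType) (w : orientation pi).

Lemma orient_sq g : w g * w g = 1.
Proof. by have [->|->] := orient_pm1 w g. Qed.

Lemma orient1 : w 1%g = 1.
Proof.
by rewrite -[RHS](orient_sq 1%g) -orientM mulg1.
Qed.

Lemma orientV g : w g^-1%g = w g.
Proof.
have := orientM w g g^-1; rewrite mulgV orient1.
by have [->|->] := orient_pm1 w g; have [->|->] := orient_pm1 w g^-1%g.
Qed.

Definition bar (a : groupring pi) : groupring pi :=
  malg_lift (fun g => gr g^-1%g *~ w g) a.

Lemma bar_is_zmod_morphism : zmod_morphism bar.
Proof. by move=> a b; rewrite /bar raddfB. Qed.

HB.instance Definition _ :=
  GRing.isZmodMorphism.Build (groupring pi) (groupring pi) bar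
    bar_is_zmod_morphism.

Lemma barB : {morph bar : a b / a - b}.
Proof. exact: raddfB. Qed.

Lemma barD : {morph bar : a b / a + b}.
Proof. exact: raddfD. Qed.

Lemma barN : {morph bar : a / - a}.
Proof. exact: raddfN. Qed.

Lemma bar_gr g : bar (gr g) = gr g^-1%g *~ w g.
Proof. by rewrite /bar malg_liftU. Qed.

Lemma barM a b : bar (a * b) = bar b * bar a.
Proof.
elim/gr_ind: a => [|a a' IH IH'|g].
- by rewrite mul0r raddf0 mulr0.
- by rewrite mulrBl !barB mulrBr IH IH'.
elim/gr_ind: b => [|b b' IH IH'|h].
- by rewrite mulr0 raddf0 mul0r.
- by rewrite mulrBr !barB mulrBl IH IH'.
by rewrite -grM !bar_gr invgM grM orientM mulrzAl mulrzAr -mulrzA.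
Qed.

Lemma bar1 : bar 1 = 1.
Proof. by rewrite -gr1 bar_gr invg1 orient1. Qed.

Lemma barK : involutive bar.
Proof.
elim/gr_ind => [|a b IH IH'|g]; first by rewrite !raddf0.
  by rewrite !barB IH IH'.
by rewrite bar_gr raddfMz /= bar_gr invgK orientV -mulrzA orient_sq.
Qed.

End Involution.

Definition finitely_generated (R : pzRingType) (M : lmodType R) : Prop :=
  exists n (x : 'I_n -> M), forall m, exists c : 'I_n -> R,
    m = \sum_(i < n) c i *: x i.

Definition projective (R : pzRingType) (M : lmodType R) : Prop :=
  forall (N P : lmodType R) (p : {linear N -> P}) (f : {linear M -> P}),
    (forall y, exists x, p x = y) -> exists h : {linear M -> N}, p \o h =1 f.

(** [Hom_R(M, R)], a right [R]-module by [(f r) m = (f m) r]. *)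
Section Dual.
Variables (R : pzRingType) (M : lmodType R).

Definition dual : Type := {scalar M}.

HB.instance Definition _ := gen_eqMixin dual.
HB.instance Definition _ := gen_choiceMixin dual.

Implicit Types f g : dual.

Lemma dualP f g : f =1 g -> f = g.
Proof.
case: f g => [f [[fn] [fs]]] [g [[gn] [gs]]] /= /funext fg.
by case: _ / fg in gn gs *; rewrite (Prop_irrelevance fn gn) (Prop_irrelevance fs gs).
Qed.

Definition dual0 : dual := \0.
Definition dualD f g : dual := f \+ g.
Definition dualN f : dual := \- f.

Lemma dualDA : associative dualD.
Proof. by move=> f g h; apply: dualP => m /=; rewrite addrA. Qed.
Lemma dualDC : commutative dualD.
Proof. by move=> f g; apply: dualP => m /=; rewrite addrC. Qed.
Lemma dual0D : left_id dual0 dualD.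
Proof. by move=> f; apply: dualP => m /=; rewrite add0r. Qed.
Lemma dualND : left_inverse dual0 dualN dualD.
Proof. by move=> f; apply: dualP => m /=; rewrite addNr. Qed.

HB.instance Definition _ :=
  GRing.isZmodule.Build dual dualDA dualDC dual0D dualND.

Lemma dualDE f g m : (f + g) m = f m + g m. Proof. by []. Qed.
Lemma dualNE f m : (- f) m = - f m. Proof. by []. Qed.
Lemma dual0E m : (0 : dual) m = 0. Proof. by []. Qed.

Lemma dual_scale_subproof (r : R) f : scalar (fun m => f m * r).
Proof. by move=> a x y; rewrite linearP mulrDl mulrA. Qed.

Definition dual_scale (r : R^c) (f : dual) : dual :=
  HB.pack (fun m => f m * r) (GRing.isLinear.Build R M R *%R _ (dual_scale_subproof r f)).

Lemma dual_scaleA r s f : dual_scale r (dual_scale s f) = dual_scale (r * s) f.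
Proof. by apply: dualP => m /=; rewrite -mulrA. Qed.
Lemma dual_scale1 : left_id 1 dual_scale.
Proof. by move=> f; apply: dualP => m; apply: mulr1. Qed.
Lemma dual_scaleDr : right_distributive dual_scale +%R.
Proof. by move=> r f g; apply: dualP => m; apply: mulrDl. Qed.
Lemma dual_scaleDl f : {morph dual_scale^~ f : r s / r + s}.
Proof. by move=> r s; apply: dualP => m; apply: mulrDr. Qed.

HB.instance Definition _ := GRing.Zmodule_isLmodule.Build R^c dual
  dual_scaleA dual_scale1 dual_scaleDr dual_scaleDl.

Lemma dualZE (r : R) f m : ((r : R^c) *: f) m = f m * r. Proof. by []. Qed.
End Dual.

(** The right module [N] made into a left module by [r n = n (bar r)]. *)
Definition conjmod (pi : groupType) of orientation pi :=
  fun N : lmodType (groupring pi)^c => N : Type.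

Section Conjugate.
Variables (pi : groupType) (w : orientation pi) (N : lmodType (groupring pi)^c).

HB.instance Definition _ := GRing.Zmodule.on (conjmod w N).

Definition conjmod_scale (r : groupring pi) (n : conjmod w N) : conjmod w N :=
  (bar w r : (groupring pi)^c) *: (n : N).

Lemma conjmod_scaleA r s n :
  conjmod_scale r (conjmod_scale s n) = conjmod_scale (r * s) n.
Proof. by rewrite /conjmod_scale barM; apply: scalerA. Qed.
Lemma conjmod_scale1 : left_id 1 conjmod_scale.
Proof. by move=> n; rewrite /conjmod_scale bar1; apply: scale1r. Qed.
Lemma conjmod_scaleDr : right_distributive conjmod_scale +%R.
Proof. by move=> r m n; apply: scalerDr. Qed.
Lemma conjmod_scaleDl n : {morph conjmod_scale^~ n : r s / r + s}.
Proof. by move=> r s; rewrite /conjmod_scale barD; apply: scalerDl. Qed.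

HB.instance Definition _ :=
  GRing.Zmodule_isLmodule.Build (groupring pi) (conjmod w N)
    conjmod_scaleA conjmod_scale1 conjmod_scaleDr conjmod_scaleDl.
End Conjugate.

Definition dagger (pi : groupType) (w : orientation pi)
    (M : lmodType (groupring pi)) : lmodType (groupring pi) :=
  conjmod w (dual M).

Lemma daggerZE (pi : groupType) (w : orientation pi)
    (M : lmodType (groupring pi)) (r : groupring pi) (n : dagger w M) (m : M) :
  (r *: n : dual M) m = (n : dual M) m * bar w r.
Proof. by []. Qed.

(** [Z^w] is needed as a right module only, whence [(groupring pi)^c]; the action
    of [r] is the additive extension of [k g = w(g) k]. *)
Section SignModule.
Variables (pi : groupType) (w : orientation pi).

Definition Zw of orientation pi : Type := int.
HB.instance Definition _ := GRing.Zmodule.on (Zw w).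

Definition Zw_scale (r : (groupring pi)^c) (k : Zw w) : Zw w :=
  malg_lift (fun g => k * w g : int) r.

Lemma Zw_scaleg g k : Zw_scale (gr g) k = (k * w g : int).
Proof. exact: malg_liftU. Qed.
Lemma Zw_scaleDl k : {morph Zw_scale^~ k : r s / r + s}.
Proof. by move=> r s; apply: raddfD. Qed.
Lemma Zw_scaleBl k r s : Zw_scale (r - s) k = Zw_scale r k - Zw_scale s k.
Proof. exact: raddfB. Qed.
Lemma Zw_scale0l k : Zw_scale 0 k = 0.
Proof. exact: raddf0. Qed.
Lemma Zw_scaleDr : right_distributive Zw_scale +%R.
Proof.
move=> r k l; rewrite /Zw_scale !(malg_liftEw _ (fsubset_refl _)) -big_split.
by apply: eq_bigr => g _; rewrite mulrDl mulrzDl.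
Qed.
Lemma Zw_scale0r r : Zw_scale r 0 = 0.
Proof. by apply: (addrI (Zw_scale r 0)); rewrite -Zw_scaleDr !addr0. Qed.
Lemma Zw_scaleBr r k l : Zw_scale r (k - l) = Zw_scale r k - Zw_scale r l.
Proof. by apply/eqP; rewrite eq_sym subr_eq -Zw_scaleDr subrK. Qed.

Lemma Zw_scaleA r s k : Zw_scale r (Zw_scale s k) = Zw_scale (r * s) k.
Proof.
elim/gr_ind: r => [|a b IH IH'|g].
- by rewrite mul0r !Zw_scale0l.
- by rewrite mulrBl !Zw_scaleBl IH IH'.
elim/gr_ind: s => [|a b IH IH'|h].
- by rewrite mulr0 !Zw_scale0l Zw_scale0r.
- by rewrite mulrBr !Zw_scaleBl Zw_scaleBr IH IH'.
have -> : (gr g : (groupring pi)^c) * gr h = gr (h * g)%g by rewrite grM.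
by rewrite !Zw_scaleg orientM mulrA.
Qed.

Lemma Zw_scale1 : left_id 1 Zw_scale.
Proof. by move=> k; apply: etrans (Zw_scaleg 1%g k) _; rewrite orient1 mulr1. Qed.

HB.instance Definition _ := GRing.Zmodule_isLmodule.Build (groupring pi)^c (Zw w)
  Zw_scaleA Zw_scale1 Zw_scaleDr Zw_scaleDl.
End SignModule.

(** A group element [g] acts on [gammaW M] by functoriality. A general [r] acts by
    the additive extension of this, not by [gammaW_map] of its action on [M], as
    [gammaW] is not an additive functor. *)
Section GammaWModule.
Variables (pi : groupType) (M : lmodType (groupring pi)).

Definition gammaW_act (g : pi) : gammaW M -> gammaW M :=
  gammaW_map ( *:%R (gr g) : {additive M -> M}).
HB.instance Definition _ g := GRing.Additive.on (gammaW_act g).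

Definition gammaW_scale (r : groupring pi) (x : gammaW M) : gammaW M :=
  malg_lift (fun g => gammaW_act g x) r.

Lemma gammaW_act_gamma g m : gammaW_act g (gamma m) = gamma (gr g *: m).
Proof. exact: gammaW_mapE. Qed.

Lemma gammaW_actM g h x : gammaW_act (g * h)%g x = gammaW_act g (gammaW_act h x).
Proof.
apply: (gammaW_additive_eq (f := gammaW_act (g * h)%g)
          (g := gammaW_act g \o gammaW_act h)) => m /=.
by rewrite !gammaW_act_gamma grM scalerA.
Qed.

Lemma gammaW_act1 x : gammaW_act 1%g x = x.
Proof.
apply: (gammaW_additive_eq (f := gammaW_act 1%g) (g := idfun)) => m /=.
by rewrite gammaW_act_gamma gr1 scale1r.
Qed.

Lemma gammaW_scale_gr g x : gammaW_scale (gr g) x = gammaW_act g x.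
Proof. exact: malg_liftU. Qed.
Lemma gammaW_scaleDl x : {morph gammaW_scale^~ x : r s / r + s}.
Proof. by move=> r s; apply: raddfD. Qed.
Lemma gammaW_scaleBl x r s :
  gammaW_scale (r - s) x = gammaW_scale r x - gammaW_scale s x.
Proof. exact: raddfB. Qed.
Lemma gammaW_scale0l x : gammaW_scale 0 x = 0.
Proof. exact: raddf0. Qed.
Lemma gammaW_scaleDr : right_distributive gammaW_scale +%R.
Proof.
move=> r x y; rewrite /gammaW_scale !(malg_liftEw _ (fsubset_refl _)) -big_split.
by apply: eq_bigr => g _; rewrite (raddfD (gammaW_act g)) mulrzDl.
Qed.
Lemma gammaW_scale0r r : gammaW_scale r 0 = 0.
Proof. by apply: (addrI (gammaW_scale r 0)); rewrite -gammaW_scaleDr !addr0. Qed.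
Lemma gammaW_scaleBr r x y :
  gammaW_scale r (x - y) = gammaW_scale r x - gammaW_scale r y.
Proof. by apply/eqP; rewrite eq_sym subr_eq -gammaW_scaleDr subrK. Qed.

Lemma gammaW_scaleA r s x :
  gammaW_scale r (gammaW_scale s x) = gammaW_scale (r * s) x.
Proof.
elim/gr_ind: r => [|a b IH IH'|g].
- by rewrite mul0r !gammaW_scale0l.
- by rewrite mulrBl !gammaW_scaleBl IH IH'.
elim/gr_ind: s => [|a b IH IH'|h].
- by rewrite mulr0 !gammaW_scale0l gammaW_scale0r.
- by rewrite mulrBr !gammaW_scaleBl gammaW_scaleBr IH IH'.
by rewrite -grM !gammaW_scale_gr gammaW_actM.
Qed.

Lemma gammaW_scale1 : left_id 1 gammaW_scale.
Proof. by move=> x; rewrite -gr1 gammaW_scale_gr gammaW_act1. Qed.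

HB.instance Definition _ :=
  GRing.Zmodule_isLmodule.Build (groupring pi) (gammaW M)
    gammaW_scaleA gammaW_scale1 gammaW_scaleDr gammaW_scaleDl.

Lemma gammaW_scale_gamma g m : gr g *: gamma m = gamma (gr g *: m).
Proof. by apply: etrans (gammaW_scale_gr _ _) (gammaW_act_gamma _ _). Qed.
End GammaWModule.

Section Hermitean.
Variables (pi : groupType) (w : orientation pi) (N : lmodType (groupring pi)).

Definition hermitean (b : N -> N -> groupring pi) : Prop :=
  (forall m, scalar (b^~ m)) /\ (forall n m, b n m = bar w (b m n)).

Definition hermitean_pred : {pred N -> N -> groupring pi} :=
  fun b => `[< hermitean b >].

Record Her := MkHer {
  Her_val :> N -> N -> groupring pi;
  _ : hermitean_pred Her_val
}.

HB.instance Definition _ := [isSub for Her_val].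
HB.instance Definition _ := [Choice of Her by <:].

Lemma hermiteanP b : reflect (hermitean b) (b \in hermitean_pred).
Proof. by rewrite unfold_in; apply: asboolP. Qed.

Lemma hermitean_zmod_closed : zmod_closed hermitean_pred.
Proof.
split=> [|b c /hermiteanP[bl bh] /hermiteanP[cl ch]]; apply/hermiteanP.
  have E x y : (0 : N -> N -> groupring pi) x y = 0 by [].
  by split=> [m a x y|n m]; rewrite !E ?mulr0 ?addr0 ?raddf0.
split=> [m a x y|n m].
  have -> z : (b - c) z m = b z m - c z m by [].
  by rewrite bl cl mulrBr opprD addrACA.
have -> x y : (b - c) x y = b x y - c x y by [].
by rewrite barB -bh -ch.
Qed.

HB.instance Definition _ := GRing.isZmodClosed.Build (N -> N -> groupring pi)
  hermitean_pred hermitean_zmod_closed.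
HB.instance Definition _ := [SubChoice_isSubZmodule of Her by <:].

Lemma Her_hermitean (b : Her) : hermitean b.
Proof. exact/hermiteanP/(valP b). Qed.

Lemma Her_linear (b : Her) m : scalar (b^~ m).
Proof. by have [] := Her_hermitean b. Qed.

Lemma Her_sym (b : Her) n m : b n m = bar w (b m n).
Proof. by have [] := Her_hermitean b. Qed.

Lemma HerP (b c : Her) : (forall n m, b n m = c n m) -> b = c.
Proof. by move=> bc; apply/val_inj/funext => n; apply/funext => m; apply: bc. Qed.

Lemma HerDE (b c : Her) n m : (b + c) n m = b n m + c n m. Proof. by []. Qed.
Lemma HerNE (b : Her) n m : (- b) n m = - b n m. Proof. by []. Qed.
Lemma HerMzE (b : Her) k n m : (b *~ k) n m = b n m *~ k.
Proof.
have HMn (c : Her) i : (c *+ i) n m = c n m *+ i.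
  by elim: i => [|i IH]; rewrite ?mulr0n // !mulrS HerDE IH.
by case: k => i; rewrite ?NegzE ?mulrNz ?HerNE -?pmulrn HMn.
Qed.
End Hermitean.

Section Evaluation.
Variables (pi : groupType) (w : orientation pi) (M : lmodType (groupring pi)).

Definition ev_fun (m : M) (n n' : dagger w M) : groupring pi :=
  bar w ((n : dual M) m) * (n' : dual M) m.

Lemma ev_hermitean m : hermitean_pred w (ev_fun m).
Proof.
apply/hermiteanP; split=> [n' a n1 n2|n n']; rewrite /ev_fun.
  have -> : (a *: n1 + n2 : dual M) m =
            (n1 : dual M) m * bar w a + (n2 : dual M) m by [].
  by rewrite barD barM barK mulrDl mulrA.
by rewrite barM barK.
Qed.

Definition ev (m : M) : Her w (dagger w M) := MkHer (ev_hermitean m).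

Lemma evE m n n' : ev m n n' = bar w ((n : dual M) m) * (n' : dual M) m.
Proof. by []. Qed.

Lemma polar_ev m1 m2 n n' : polar ev m1 m2 n n' =
  bar w ((n : dual M) m1) * (n' : dual M) m2 +
  bar w ((n : dual M) m2) * (n' : dual M) m1.
Proof.
rewrite /polar !HerDE !HerNE !evE !linearD barD !mulrDl !mulrDr.
have E (x y z t : groupring pi) : x + y + (z + t) - x - t = y + z.
  by rewrite (addrA (x + y)) (addrAC _ (- x)) addrK -(addrA x) [x + _]addrC addrK.
exact: E.
Qed.

Lemma ev_quadratic : quadratic ev.
Proof.
split=> [m|]; first by apply: HerP => n n'; rewrite !evE !linearN barN mulrNN.
split=> [a a' b|a b b']; apply: HerP => n n'.
  apply: etrans (polar_ev _ _ _ _) _; rewrite HerDE (polar_ev a b) (polar_ev a' b).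
  by rewrite !linearD barD mulrDl mulrDr addrACA.
apply: etrans (polar_ev _ _ _ _) _; rewrite HerDE (polar_ev a b) (polar_ev a b').
by rewrite !linearD barD mulrDl mulrDr addrACA.
Qed.

Lemma ev_gr g m : ev (gr g *: m) = ev m *~ w g.
Proof.
apply: HerP => n n'; rewrite HerMzE !evE !linearZ /= barM bar_gr.
rewrite mulrA -[_ * _ * gr g]mulrA mulrzAl -grM mulVg gr1.
by rewrite mulrzAr mulr1 mulrzAl.
Qed.

Definition BM_fun (k : Zw w) (x : gammaW M) : Her w (dagger w M) :=
  gammaW_lift ev_quadratic x *~ (k : int).

Lemma BM_balanced : balanced BM_fun.
Proof.
split; first split=> [k k' x|k x x']; rewrite /BM_fun.
- exact: mulrzDr.
- by rewrite raddfD mulrzDl.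
move=> k r x; elim/gr_ind: r => [|a b IH IH'|g].
- have -> : (0 : (groupring pi)^c) *: k = 0 by apply: scale0r.
  by rewrite scale0r /BM_fun (raddf0 (gammaW_lift _)) mul0rz; apply: mulr0z.
- have -> : (a - b : (groupring pi)^c) *: k =
      (a : (groupring pi)^c) *: k - (b : (groupring pi)^c) *: k.
    by apply: scalerBl.
  rewrite /BM_fun in IH IH' *.
  rewrite scalerBl (raddfB (gammaW_lift _)) mulrzBl -IH -IH'.
  exact: mulrzBr.
have -> : gr g *: x = gammaW_act g x by apply: gammaW_scale_gr.
have -> : (gr g : (groupring pi)^c) *: k = (k * w g : int) by apply: Zw_scaleg.
rewrite /BM_fun [k * _]mulrC mulrzA; congr (_ *~ _).
pose L := gammaW_lift ev_quadratic.
have LE m : L (gammaW_act g (gamma m)) = L (gamma m) *~ w g.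
  by rewrite gammaW_act_gamma /L !gammaW_liftE ev_gr.
have [wg|wg] := orient_pm1 w g; rewrite wg.
  rewrite mulr1z; apply: (gammaW_additive_eq (f := L) (g := L \o gammaW_act g)).
  by move=> m; apply/esym; apply: etrans (LE m) _; rewrite wg mulr1z.
rewrite mulrN1z.
apply: (gammaW_additive_eq (f := -%R \o L) (g := L \o gammaW_act g)) => m.
by apply/esym; apply: etrans (LE m) _; rewrite wg mulrN1z.
Qed.

(** Characterized by [BM_gamma] and [BM_unique]. *)
Definition BM : tensor (Zw w) (gammaW M) -> Her w (dagger w M) :=
  tensor_lift BM_balanced.
HB.instance Definition _ := GRing.Additive.on BM.

Lemma BM_gamma (m : M) : BM (tens (1%:Z : Zw w) (gamma m)) = ev m.
Proof.
apply: etrans (tensor_liftE BM_balanced _ _) _.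
by rewrite /BM_fun gammaW_liftE.
Qed.

Lemma tens_Zw (k : int) (x : gammaW M) :
  tens (k : Zw w) x = tens (1%:Z : Zw w) x *~ k.
Proof.
have [[tDl _] _] := @tens_balanced _ (Zw w) (gammaW M).
pose t (i : int) := tens (i : Zw w) x.
have tB : zmod_morphism t.
  by move=> i j; apply/eqP; rewrite eq_sym subr_eq -[t (i - j) + _]tDl subrK.
pose T : {additive int -> tensor (Zw w) (gammaW M)} :=
  HB.pack t (GRing.isZmodMorphism.Build _ _ t tB).
by rewrite -[k in LHS]intz; apply: (raddfMz T).
Qed.

Lemma BM_unique (f : {additive tensor (Zw w) (gammaW M) -> Her w (dagger w M)}) :
  (forall m, f (tens (1%:Z : Zw w) (gamma m)) = ev m) -> f =1 BM.
Proof.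
move=> fE; apply: tensor_additive_eq => k x.
rewrite !(tens_Zw k) !raddfMz; congr (_ *~ _).
have [[_ tDr] _] := @tens_balanced _ (Zw w) (gammaW M).
pose t (y : gammaW M) := tens (1%:Z : Zw w) y.
have tB : zmod_morphism t.
  by move=> i j; apply/eqP; rewrite eq_sym subr_eq -[t (i - j) + _]tDr subrK.
pose T : {additive gammaW M -> tensor (Zw w) (gammaW M)} :=
  HB.pack t (GRing.isZmodMorphism.Build _ _ t tB).
apply: (gammaW_additive_eq (f := f \o T) (g := BM \o T)) => m.
exact: etrans (fE m) (esym (BM_gamma m)).
Qed.

End Evaluation.

Arguments BM { pi } w M t.

Definition order2 (pi : groupType) (g : pi) : Prop :=
  g <> 1%g /\ (g ^+ 2)%g = 1%g.

(* Main.v *)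
(** For a dual basis [x_i], [f_i] of [M] write [q m] for [1 (x) gamma m] and
    [<m, m'>] for its polarization. As [q (g m) = w(g) q m], one has
    [<r m, m'> = <m, bar r m'>], so expanding [m = sum_i f_i(m) x_i] puts every
    element [t] of the tensor product in the form
      [sum_i (k_i q(x_i) + <x_i, s_i x_i>)
         + sum_(j < i) <x_i, b(f_i, f_j) x_j>],
    where [b = B_M t] and [b(f_i, f_i) = k_i + s_i + bar s_i]. Conversely, any
    such choice of [k_i], [s_i] for a hermitean [b] gives a preimage of [b].
    It remains to pair up [g] and [g^-1] in the group ring: if no [g] of order 2
    has [w g = 1] then [a = bar a] implies [a = k + s + bar s], and if none has
    [w g = -1] then [k + s + bar s = 0] forces [k q(x) + <x, s x> = 0], because
    [<x, bar s x> = <x, s x>]. *)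

Require Import Defs.
From HB Require Import structures.
From mathcomp Require Import all_boot all_order all_algebra.
From mathcomp Require Import finmap zify.
From mathcomp.multinomials Require Import monalg.

Set Implicit Arguments.
Unset Strict Implicit.
Unset Printing Implicit Defensive.

Import GRing.Theory.
Local Open Scope ring_scope.

(** * Polarization calculus for quadratic functions *)

Section Quadratic.
Variables (A B : zmodType) (f : A -> B).
Hypothesis fq : quadratic f.

Lemma quadraticN a : f (- a) = f a.
Proof. by case: fq. Qed.

Lemma polarDl a a' b : polar f (a + a') b = polar f a b + polar f a' b.
Proof. by case: fq => _ []. Qed.

Lemma polarDr a b b' : polar f a (b + b') = polar f a b + polar f a b'.
Proof. by case: fq => _ []. Qed.

Lemma quadraticD a b : f (a + b) = f a + f b + polar f a b.
Proof.
have -> : polar f a b = f (a + b) - (f a + f b) by rewrite opprD addrA.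
by rewrite [RHS]addrC subrK.
Qed.

Lemma polarC a b : polar f a b = polar f b a.
Proof. by rewrite /polar [b + a]addrC addrAC. Qed.

Lemma polar0r a : polar f a 0 = 0.
Proof. by apply: (addrI (polar f a 0)); rewrite -polarDr !addr0. Qed.

Lemma quadratic0 : f 0 = 0.
Proof.
by apply: oppr_inj; rewrite oppr0 -[RHS](polar0r 0) /polar addr0 subrr sub0r.
Qed.

Lemma polarNr a b : polar f a (- b) = - polar f a b.
Proof. by apply/eqP; rewrite -addr_eq0 -polarDr addNr polar0r. Qed.

Lemma polarBr a b b' : polar f a (b - b') = polar f a b - polar f a b'.
Proof. by rewrite polarDr polarNr. Qed.

Lemma polarMzr a b k : polar f a (b *~ k) = polar f a b *~ k.
Proof.
pose p : {additive A -> B} :=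
  HB.pack (polar f a) (GRing.isZmodMorphism.Build A B (polar f a) (polarBr a)).
exact: (raddfMz p).
Qed.

(** Polarizing at [a] and [- a] leaves [- f a - f (- a)], and evenness merges the two terms. *)
Lemma polar_diag a : polar f a a = f a *+ 2.
Proof.
have -> : polar f a a = - polar f a (- a) by rewrite polarNr opprK.
by rewrite /polar subrr quadratic0 quadraticN sub0r -opprD opprK.
Qed.

Lemma polar_suml I (r : seq I) (P : pred I) (F : I -> A) b :
  polar f (\sum_(i <- r | P i) F i) b = \sum_(i <- r | P i) polar f (F i) b.
Proof.
rewrite polarC (big_morph _ (polarDr b) (polar0r b)).
by apply: eq_bigr => i _; rewrite polarC.
Qed.

Lemma quadratic_sum n (F : 'I_n -> A) :
  f (\sum_i F i) =
  \sum_i f (F i) + \sum_(i < n) \sum_(j < n | (j < i)%N) polar f (F i) (F j).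
Proof.
elim: n F => [|n IHn] F; first by rewrite !big_ord0 quadratic0 addr0.
rewrite !big_ord_recr /= quadraticD IHn polar_suml.
have -> : \sum_(j < n.+1 | (j < n)%N) polar f (F ord_max) (F j) =
          \sum_(j < n) polar f (F (widen_ord (leqnSn n) j)) (F ord_max).
  rewrite big_mkcond big_ord_recr /= ltnn addr0; apply: eq_bigr => j _.
  by rewrite ltn_ord polarC.
rewrite !addrA; congr (_ + _); rewrite addrAC; congr (_ + _ + _).
apply: eq_bigr => i _; rewrite [RHS]big_mkcond big_ord_recr /=.
by rewrite ltnNge ltnW //= addr0 -big_mkcond.
Qed.

End Quadratic.

(** Reflecting the upper triangle onto the lower one brings the expansion of a hermitean pairing
    into the shape of a normal form. *)
Lemma sum_ord_symmetrize (V : zmodType) n (F : 'I_n -> 'I_n -> V) :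
  \sum_i \sum_j F i j =
  \sum_i F i i + \sum_(i < n) \sum_(j < n | (j < i)%N) (F i j + F j i).
Proof.
under [X in _ = _ + X]eq_bigr => i _ do rewrite big_split /=.
rewrite big_split /=.
rewrite [X in _ + (_ + X)](exchange_big_dep predT) //= -!big_split /=.
apply: eq_bigr => i _; rewrite (bigID (fun j : 'I_n => (j < i)%N)) /= addrCA.
congr (_ + _); rewrite (bigD1 i) ?ltnn //=; congr (_ + _).
by apply: eq_bigl => j; rewrite -leqNgt -val_eqE /=; lia.
Qed.

(** * Dual bases of finitely generated projective modules *)

Section DualBasis.
Variables (R : nzRingType) (M : lmodType R).

Definition row_comb n (x : 'I_n -> M) (v : 'rV[R]_n) : M := \sum_i v 0 i *: x i.

Lemma row_comb_is_linear n (x : 'I_n -> M) : linear (row_comb x).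
Proof.
move=> a u v; rewrite /row_comb scaler_sumr -big_split; apply: eq_bigr => i _.
by rewrite !mxE scalerDl scalerA.
Qed.

HB.instance Definition _ n (x : 'I_n -> M) :=
  GRing.isLinear.Build R 'rV[R]_n M *:%R (row_comb x) (row_comb_is_linear x).

(** Generators give a surjection from a free module; projectivity splits it, and the coordinates of
    the section are the [f i]. *)
Lemma dual_basis : finitely_generated M -> projective M ->
  exists n (x : 'I_n -> M) (f : 'I_n -> dual M),
    forall m, m = \sum_i f i m *: x i.
Proof.
move=> [n [x xgen]] Mproj.
case: (Mproj _ _ (row_comb x : {linear _ -> _}) (idfun : {linear M -> M}))
    => [m|h hK].
  have [c ->] := xgen m; exists (\row_i c i).
  by apply: eq_bigr => i _; rewrite mxE.
have flin i : scalar (fun m => h m 0 i) by move=> a u v; rewrite linearP !mxE.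
pose f i : {scalar M} :=
  HB.pack (fun m => h m 0 i) (GRing.isLinear.Build R M R *%R _ (flin i)).
exists n, x, f.
by move=> m; rewrite -[LHS]hK.
Qed.

End DualBasis.

(** * Elements of the group ring fixed up to sign by the involution *)

Section SelfConjugate.
Variables (pi : groupType) (w : orientation pi).
Implicit Types a s : groupring pi.

Lemma mcoeff_bar a g :
  (bar w a : {malg int[pi]})@_g = (a : {malg int[pi]})@_(g^-1)%g * w g.
Proof.
elim/gr_ind: a => [|a b IHa IHb|h].
- by rewrite raddf0 !mcoeff0 mul0r.
- by rewrite barB !mcoeffB IHa IHb mulrBl.
rewrite bar_gr; have [->|gh] := eqVneq g h^-1%g.
  by rewrite raddfMz /= /gr mcoeffUU invgK mcoeffUU orientV mul1r -[RHS]intz.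
rewrite raddfMz /= /gr !mcoeffU [_^-1%g == _]eq_sym (negPf gh) mul0rz.
by rewrite -(inj_eq invg_inj) invgK eq_sym (negPf gh) mul0r.
Qed.

Lemma mcoeffMz a k g :
  ((a *~ k : groupring pi) : {malg int[pi]})@_g = (a : {malg int[pi]})@_g * k.
Proof. by rewrite -mulrzz; apply: (raddfMz (mcoeff g)). Qed.

Lemma mcoeff_int k g :
  ((k%:~R : groupring pi) : {malg int[pi]})@_g = (1%g == g)%:R * k.
Proof. by rewrite mcoeffMz -gr1 /gr mcoeffU. Qed.

(* The coefficient of [a] at [g^-1] is [e w(g)] times that at [g]: the elements
   [g <> g^-1] pair up, and a coefficient at an involution [g] vanishes as
   [w g = -e]. *)
Lemma self_conjugate_decomp (e : int) a :
    e = 1 \/ e = -1 -> ~ (exists g : pi, order2 g /\ w g = e) ->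
    a = bar w a *~ e ->
  exists s, a = ((a : {malg int[pi]})@_1%g)%:~R + s + bar w s *~ e.
Proof.
move=> e1 no2 aE; pose c g := (a : {malg int[pi]})@_g.
have cV g : c g = c g^-1%g * w g * e by rewrite /c {1}aE mcoeffMz mcoeff_bar.
pose d := msupp (a : {malg int[pi]}).
have dP g : (g \in d) = (c g != 0) by rewrite mcoeff_neq0.
(* From each pair of distinct [g] and [g^-1], [s] keeps the one enumerated first in the support;
   [bar w s *~ e] then supplies the other. *)
pose s : {malg int[pi]} :=
  [malg g in d => if (index g d < index g^-1%g d)%N then c g else 0].
have sE g : s@_g = if (index g d < index g^-1%g d)%N then c g else 0.
  rewrite mcoeffE; case: ifP => //; rewrite dP => /negbFE/eqP ->.
  by case: ifP.
exists (s : groupring pi); apply/malgP => g; rewrite -/(c g).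
rewrite !mcoeffD mcoeffMz mcoeff_int mcoeff_bar -/(c 1%g) !sE invgK.
case: ltngtP => [idx_lt|idx_gt|idx_eq].
- have [g1|_] := eqVneq 1%g g; first by move: idx_lt; rewrite -g1 invg1 ltnn.
  by rewrite !mul0r add0r addr0.
- have [g1|_] := eqVneq 1%g g; first by move: idx_gt; rewrite -g1 invg1 ltnn.
  by rewrite mul0r !add0r -cV.
rewrite !mul0r !addr0; have [<-|g_neq1] := eqVneq 1%g g; first by rewrite mul1r.
rewrite mul0r; apply/eqP/negPn/negP => cg_neq0.
(* Equal indices give [g = g^-1] only inside the support, as all elements outside it share the index
   [size d]. *)
have cgV_neq0 : c g^-1%g != 0.
  by apply: contraNneq cg_neq0 => cg0; rewrite cV cg0 !mul0r.
have gV : g = g^-1%g by apply: (index_inj g _ _ idx_eq); rewrite -/(_ \in d) dP.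
have wgNe : w g != e.
  apply/eqP => wge; apply: no2; exists g; split=> //; split.
    by move=> g1; rewrite g1 eqxx in g_neq1.
  by rewrite expgS expg1 {2}gV mulgV.
move: (cV g) wgNe cg_neq0; rewrite -gV.
by have [->|->] := orient_pm1 w g; case: e1 => ->; lia.
Qed.

End SelfConjugate.

(** * Quadratic functions on which the group acts through [w] *)

Section TwistedQuadratic.
Variables (pi : groupType) (w : orientation pi) (M : lmodType (groupring pi)).
Variables (T : zmodType) (q : M -> T).
Hypothesis qq : quadratic q.
Hypothesis q_gr : forall g m, q (gr g *: m) = q m *~ w g.
Implicit Types (m x : M) (r s : groupring pi).

(** Both sides are additive in [r]; for a group element [g], write [x] as [g (g^-1 x)] and pull out
    the common [g] at the cost of [w g]. *)
Lemma polar_adjoint r m x : polar q (r *: m) x = polar q m (bar w r *: x).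
Proof.
elim/gr_ind: r => [|a b IHa IHb|g].
- by rewrite raddf0 !scale0r polarC !(polar0r qq).
- rewrite barB !scalerBl (polarBr qq) -IHa -IHb.
  by rewrite polarC (polarBr qq) !(polarC q x).
have grK : gr g *: (gr g^-1%g *: x) = x.
  by rewrite scalerA -grM mulgV gr1 scale1r.
rewrite -{1}grK bar_gr; set y := gr g^-1%g *: x.
have -> : polar q (gr g *: m) (gr g *: y) = polar q m y *~ w g.
  by rewrite /polar -scalerDr !q_gr !mulrzBl.
have [->|->] := orient_pm1 w g; first by rewrite !mulr1z.
by rewrite !mulrN1z scaleNr (polarNr qq).
Qed.

Lemma polar_bar_scale x s : polar q x (bar w s *: x) = polar q x (s *: x).
Proof. by rewrite -polar_adjoint polarC. Qed.

(** The first equation does not determine [k] and [s], so one pair serving both equations is built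
    by induction on [r]. *)
Lemma quadratic_scale r x : exists k s,
  bar w r * r = k%:~R + s + bar w s /\
  q (r *: x) = q x *~ k + polar q x (s *: x).
Proof.
elim/gr_ind: r => [|a b [k [s [ksE qE]]] [l [u [luE qE']]]|g].
- exists 0, 0; rewrite raddf0 mul0r !scale0r (polar0r qq) !addr0; split=> //.
  exact: quadratic0 qq.
(* The cross terms of [bar w (a - b) * (a - b)] are [- bar w a * b] and its conjugate; the
   polarization of [q] at [a x] and [- b x] contributes the same element. *)
- exists (k + l), (s + u - bar w a * b); split.
    rewrite barB mulrBl !mulrBr ksE luE intrD barB barD barM barK.
    rewrite opprB addrACA [X in X + _]addrACA [X in X + _ + _]addrACA.
    by rewrite addrACA !addrA.
  rewrite scalerBl (quadraticD q (a *: x)) (quadraticN qq).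
  rewrite qE qE' (polarNr qq) polar_adjoint scalerA mulrzDr.
  rewrite scalerBl scalerDl (polarBr qq) (polarDr qq) [RHS]addrA.
  by rewrite [X in X - _]addrACA.
exists (w g), 0; rewrite raddf0 !addr0 scale0r (polar0r qq) addr0; split=> //.
by rewrite bar_gr mulrzAl -grM mulVg.
Qed.

End TwistedQuadratic.

(** * Sums of hermitean pairings and of their arguments *)

Section HerEvaluation.
Variables (pi : groupType) (w : orientation pi) (N : lmodType (groupring pi)).

Lemma Her_sumE I (r : seq I) (P : pred I) (F : I -> Her w N) u v :
  (\sum_(i <- r | P i) F i) u v = \sum_(i <- r | P i) F i u v.
Proof. exact: (big_morph (fun b : Her w N => b u v)). Qed.

Lemma Her_suml (b : Her w N) I (r : seq I) (F : I -> groupring pi)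
    (u : I -> N) v :
  b (\sum_(i <- r) F i *: u i) v = \sum_(i <- r) F i * b (u i) v.
Proof.
have b0 : b 0 v = 0.
  by have := Her_linear b v (-1) 0 0; rewrite scaler0 addr0 mulN1r addNr.
elim: r => [|i r IHr]; first by rewrite !big_nil.
by rewrite !big_cons (Her_linear b v) IHr.
Qed.

End HerEvaluation.

(** * Normal forms relative to a dual basis *)

Section NormalForm.
Variables (pi : groupType) (w : orientation pi) (M : lmodType (groupring pi)).
Variables (n : nat) (x : 'I_n -> M) (f : 'I_n -> dual M).
Hypothesis fK : forall m, m = \sum_i f i m *: x i.

Lemma dagger_basis (u : dagger w M) :
  u = \sum_i bar w ((u : dual M) (x i)) *: (f i : dagger w M).
Proof.
apply: dualP => m.
rewrite (big_morph (fun v : dual M => v m) (id1 := 0) (op1 := +%R)) //.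
rewrite [m in LHS]fK linear_sum; apply: eq_bigr => i _.
by rewrite daggerZE barK linearZ.
Qed.

(** The [f i] generate the dagger module, so a pairing is determined by its matrix
    [b (f i) (f j)]. *)
Lemma Her_expand (b : Her w (dagger w M)) (u v : dagger w M) :
  b u v = \sum_i \sum_j
    bar w ((u : dual M) (x i)) * b (f i) (f j) * (v : dual M) (x j).
Proof.
rewrite {1}[u]dagger_basis Her_suml; apply: eq_bigr => i _.
rewrite Her_sym {1}[v]dagger_basis Her_suml raddf_sum mulr_sumr.
by apply: eq_bigr => j _; rewrite /= barM barK -Her_sym mulrA.
Qed.

Variables (T : zmodType) (q : M -> T).
Hypothesis qq : quadratic q.
Hypothesis q_gr : forall g m, q (gr g *: m) = q m *~ w g.

(** [c] carries the entries of a hermitean matrix below the diagonal, while [k i] and [s i] encode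
    the diagonal entry [k i + s i + bar (s i)]. This keeps the expression additive in its data. *)
Definition normal_form (k : 'I_n -> int) (s : 'I_n -> groupring pi)
    (c : 'I_n -> 'I_n -> groupring pi) : T :=
  \sum_i (q (x i) *~ k i + polar q (x i) (s i *: x i)) +
  \sum_(i < n) \sum_(j < n | (j < i)%N) polar q (x i) (c i j *: x j).

Lemma normal_formB k s c l u d :
  normal_form k s c - normal_form l u d =
  normal_form (fun i => k i - l i) (fun i => s i - u i)
    (fun i j => c i j - d i j).
Proof.
rewrite /normal_form opprD addrACA -!sumrB; congr (_ + _).
  apply: eq_bigr => i _.
  by rewrite mulrzBr scalerBl (polarBr qq) opprD addrACA.
apply: eq_bigr => i _; rewrite -sumrB; apply: eq_bigr => j _.
by rewrite scalerBl (polarBr qq).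
Qed.

Lemma q_normal_form m : exists k s,
  q m = normal_form k s (fun i j => bar w (f i m) * f j m) /\
  forall i, bar w (f i m) * f i m = (k i)%:~R + s i + bar w (s i).
Proof.
have [k /fin_all_exists[s ksP]] :=
  fin_all_exists (fun i => quadratic_scale qq q_gr (f i m) (x i)).
exists k, s; split=> [|i]; last by have [] := ksP i.
rewrite {1}[m]fK (quadratic_sum qq); congr (_ + _).
  by apply: eq_bigr => i _; have [] := ksP i.
apply: eq_bigr => i _; apply: eq_bigr => j _.
by rewrite (polar_adjoint qq q_gr) scalerA.
Qed.

Variable B : {additive T -> Her w (dagger w M)}.
Hypothesis Bq : forall m, B (q m) = ev w m.

Lemma B_polar m1 m2 : B (polar q m1 m2) = polar (@ev pi w M) m1 m2.
Proof. by rewrite /polar !raddfB /= !Bq. Qed.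

(** Each polarization contributes an entry below the diagonal together with its conjugate, which by
    symmetry of [b] is the mirror entry. *)
Lemma B_normal_form k s (b : Her w (dagger w M)) :
    (forall i, b (f i) (f i) = (k i)%:~R + s i + bar w (s i)) ->
  B (normal_form k s (fun i j => b (f i) (f j))) = b.
Proof.
move=> ksP; apply: HerP => u v.
rewrite [RHS]Her_expand [RHS]sum_ord_symmetrize.
rewrite raddfD !raddf_sum HerDE !Her_sumE.
congr (_ + _); apply: eq_bigr => i _.
  rewrite raddfD (raddfMz B) B_polar HerDE HerMzE Bq evE polar_ev ksP.
  rewrite !linearZ /= barM !mulrDr !mulrDl mulrzr mulrzAl !mulrA.
  by rewrite addrA.
rewrite raddf_sum Her_sumE; apply: eq_bigr => j _.
by rewrite B_polar polar_ev !linearZ /= barM -(Her_sym b) mulrA.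
Qed.

Hypothesis q_ind : forall P : T -> Prop,
  P 0 -> (forall t u, P t -> P u -> P (t - u)) -> (forall m, P (q m)) ->
  forall t, P t.

(** The entries below the diagonal are read off from [B t] and hence are additive in [t]; only [k]
    and [s] are chosen along the induction. *)
Lemma normal_formP t : exists k s,
  t = normal_form k s (fun i j => B t (f i) (f j)) /\
  forall i, B t (f i) (f i) = (k i)%:~R + s i + bar w (s i).
Proof.
elim/q_ind: t => [|t u [k [s [tE ksP]]] [l [r [uE lrP]]]|m].
- exists (fun=> 0), (fun=> 0); rewrite !raddf0; split=> [|i].
    rewrite -(subrr (normal_form (fun=> 0) (fun=> 0) (fun _ _ => 0))).
    by rewrite normal_formB !subrr.
  by rewrite !addr0.
- exists (fun i => k i - l i), (fun i => s i - r i); split=> [|i].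
    rewrite {1}tE {1}uE normal_formB; congr normal_form.
    by rewrite raddfB.
  rewrite raddfB !HerDE HerNE ksP lrP intrB barB.
  by rewrite !opprD addrACA [X in X + _]addrACA.
have [k [s [qE ksP]]] := q_normal_form m.
by exists k, s; rewrite Bq.
Qed.

Lemma evaluation_surjective : ~ (exists g : pi, order2 g /\ w g = 1) ->
  forall b, exists t, B t = b.
Proof.
move=> no2 b.
have ks i : exists k s, b (f i) (f i) = k%:~R + s + bar w s.
  have [|s sE] := self_conjugate_decomp (or_introl erefl) no2
      (a := b (f i) (f i)).
    by rewrite mulr1z; apply: Her_sym.
  by do 2!eexists; rewrite {1}sE mulr1z.
have [k /fin_all_exists[s ksP]] := fin_all_exists ks.
by exists (normal_form k s (fun i j => b (f i) (f j))); apply: B_normal_form.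
Qed.

Lemma evaluation_injective : ~ (exists g : pi, order2 g /\ w g = -1) ->
  injective B.
Proof.
move=> no2 t u /eqP; rewrite -subr_eq0 -raddfB => /eqP Btu0.
apply/eqP; rewrite -subr_eq0; apply/eqP; move: (t - u) Btu0 => {u}t Bt0.
have [k [s]] := normal_formP t; rewrite Bt0 => -[-> ksP].
rewrite /normal_form [X in _ + X]big1 ?addr0 => [|i _]; last first.
  by apply: big1 => j _; rewrite scale0r (polar0r qq).
apply: big1 => i _.
have ks0 : (k i)%:~R + s i + bar w (s i) = 0 by rewrite -ksP.
have [c cE] : exists c, (s i : {malg int[pi]})@_1%g = c by eexists.
(* Compare coefficients at the identity, where [s i] and [bar w (s i)] agree. *)
have kE : k i = - (c + c).
  have : (((k i)%:~R + s i + bar w (s i) : groupring pi) :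
            {malg int[pi]})@_1%g = 0.
    by rewrite ks0; apply: mcoeff0.
  by rewrite !mcoeffD mcoeff_int mcoeff_bar eqxx invg1 orient1 cE; lia.
(* [a] satisfies [bar w a = - a] and has no coefficient at the identity, so the decomposition with
   sign [-1] gives [a = u - bar w u]. *)
pose a := s i - c%:~R.
have aE : a = c%:~R - bar w (s i).
  apply/eqP; rewrite -subr_eq0 -[X in _ == X]ks0 kE mulrNz intrD.
  by rewrite opprB addrACA -opprD -[X in _ == X]addrA [X in _ == X]addrC.
have a1 : (a : {malg int[pi]})@_1%g = 0.
  by rewrite mcoeffB mcoeff_int eqxx mul1r cE subrr.
have [|u] := self_conjugate_decomp (or_intror erefl) no2 (a := a).
  by rewrite mulrN1z barB (raddfMz (bar w)) /= bar1 opprB.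
rewrite a1 add0r mulrN1z => /eqP; rewrite subr_eq addrC => /eqP ->.
(* The part [u - bar w u] polarizes to zero against [x i], and the polarization of [x i] with itself
   is [2 q (x i)], so its multiple by [c] cancels [k i = - 2 c]. *)
rewrite kE scalerDl scalerBl (polarDr qq) (polarBr qq).
rewrite (polar_bar_scale qq q_gr) subrr addr0 scaler_int (polarMzr qq).
by rewrite (polar_diag qq) mulrNz mulrzDr mulr2n mulrzDl addNr.
Qed.

End NormalForm.

(** * The twisted quadratic function from [M] to the tensor product *)

Section TensorGamma.
Variables (pi : groupType) (w : orientation pi) (M : lmodType (groupring pi)).
Implicit Types m : M.
Local Notation T := (tensor (Zw w) (gammaW M)).

Definition tens1 (y : gammaW M) : T := tens (1%:Z : Zw w) y.

Lemma tens1_is_zmod_morphism : zmod_morphism tens1.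
Proof.
have [[_ tDr] _] := @tens_balanced _ (Zw w) (gammaW M).
by move=> y z; apply/eqP; rewrite eq_sym subr_eq -[tens1 (y - z) + _]tDr subrK.
Qed.

HB.instance Definition _ :=
  GRing.isZmodMorphism.Build (gammaW M) T tens1 tens1_is_zmod_morphism.

Definition tgamma (m : M) : T := tens1 (gamma m).

Lemma polar_tgamma a b : polar tgamma a b = tens1 (polar (@gamma M) a b).
Proof. by rewrite /polar !raddfB. Qed.

Lemma tgamma_quadratic : quadratic tgamma.
Proof.
have [gN [gDl gDr]] := gamma_quadratic M.
split=> [a|]; first by rewrite /tgamma gN.
by split=> *; rewrite !polar_tgamma ?gDl ?gDr raddfD.
Qed.

(** Balancedness moves [g] across the tensor sign, where it acts on [1] in [Zw w] as [w g]. *)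
Lemma tgamma_gr g m : tgamma (gr g *: m) = tgamma m *~ w g.
Proof.
have [_ tZ] := @tens_balanced _ (Zw w) (gammaW M).
rewrite /tgamma -gammaW_scale_gamma.
apply: etrans (esym (tZ 1%:Z (gr g) (gamma m))) _.
apply: etrans (tens_Zw w (w g) (gamma m)); congr (tens _ _).
by apply: etrans (Zw_scaleg _ _) _; rewrite mul1r.
Qed.

(** The tensors [k (x) y] are the multiples [k (1 (x) y)], and the elements [gamma m] generate
    [gammaW M]. *)
Lemma tgamma_ind (P : T -> Prop) :
    P 0 -> (forall t u, P t -> P u -> P (t - u)) -> (forall m, P (tgamma m)) ->
  forall t, P t.
Proof.
move=> P0 PB Pg.
have PN t : P t -> P (- t) by move=> Pt; rewrite -sub0r; apply: PB.
have PD t u : P t -> P u -> P (t + u).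
  by move=> Pt /PN Pu; rewrite -[u]opprK; apply: PB.
have PMz t k : P t -> P (t *~ k).
  have PMn n : P t -> P (t *+ n).
    by move=> Pt; elim: n => // n IHn; rewrite mulrS; apply: PD.
  by case: k => n Pt; [apply: PMn | rewrite NegzE mulrNz; apply/PN/PMn].
have P1 y : P (tens1 y).
  elim/zquot_ind: y; elim/malg_ind => [|a b IHa IHb|m]; last exact: Pg.
    by rewrite !raddf0.
  exact: (eq_ind_r P (PB _ _ IHa IHb) (raddfB (tens1 \o @gammaW_pi M) a b)).
elim/zquot_ind; elim/malg_ind => [|a b IHa IHb|[k y]].
- by rewrite raddf0.
- exact: (eq_ind_r P (PB _ _ IHa IHb)
            (raddfB (@tensor_pi _ (Zw w) (gammaW M)) a b)).
by have := PMz _ k (P1 y); rewrite -tens_Zw.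
Qed.

End TensorGamma.

Theorem theorem3 (pi : groupType) (w : orientation pi)
    (M : lmodType (groupring pi))
    (Mfg : finitely_generated M) (Mproj : projective M) :
  (~ (exists g : pi, order2 g /\ w g = 1) ->
     forall b : Her w (dagger w M),
       exists t : tensor (Zw w) (gammaW M), BM w M t = b) /\
  (~ (exists g : pi, order2 g /\ w g = -1) -> injective (BM w M)).
Proof.
have [n [x [f fK]]] := dual_basis Mfg Mproj.
have BMq (m : M) : BM w M (tgamma w m) = ev w m := BM_gamma w m.
have tq := tgamma_quadratic w M; have tgr := @tgamma_gr pi w M.
split=> no2.
- exact: (evaluation_surjective (B := BM w M) fK BMq no2).
- exact: (evaluation_injective (B := BM w M) fK tq tgr BMq
            (@tgamma_ind pi w M) no2).
Qed.
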